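(* Let $X$, $Y$, $Z$ be Banach spaces, let $G\in L(X,Y)$ be a norm-one operator and consider $T\in L(X,Z)$. Then $T$ is a target for $G$ if and only if for all separable subspaces $X_0\subset X$ and $Y_0\subset Y$ there exist separable subspaces $X_\infty$, $Y_\infty$ satisfying $X_0\subset X_\infty\subset X$ and $Y_0\subset Y_\infty\subset Y$ and such that $G(X_\infty)\subset Y_\infty$, $G|_{X_\infty}\in L(X_\infty,Y_\infty)$ has norm one and $T|_{X_\infty}\in L(X_\infty,Z)$ is a target for $G|_{X_\infty}$.
   Context: Scalars are $\mathbb{K}=\mathbb{R}$ or $\mathbb{C}$; $\mathbb{T}=\{\omega\in\mathbb{K}:|\omega|=1\}$; subspaces are closed; $B_X$, $S_X$ are the closed unit ball and unit sphere; $\operatorname{aconv}(F)=\operatorname{conv}(\mathbb{T}F)$. Target: given a norm-one $G\in L(X,Y)$, an operator $T\in L(X,Z)$ is a target for $G$ if for every $x_0\in B_X$, every $\varepsilon>0$ and every $y\in S_Y$ there is $F\subset B_X$ such that $\operatorname{conv}(F)\subset\{x\in B_X:\|Gx+y\|>2-\varepsilon\}$ and $\operatorname{dist}(Tx_0,T(\operatorname{aconv}(F)))<\varepsilon$. *)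

(* Defs.v *)
From HB Require Import structures.
From mathcomp Require Import all_boot all_order all_algebra.
From mathcomp Require Import complex.
From mathcomp Require Import all_classical all_reals all_analysis.

Set Implicit Arguments.
Unset Strict Implicit.
Unset Printing Implicit Defensive.

Import Order.TTheory GRing.Theory Num.Theory.
Import numFieldNormedType.Exports.

Local Open Scope classical_set_scope.
Local Open Scope complex_scope.
Local Open Scope ring_scope.

Inductive real_or_complex : numFieldType -> Prop :=
  | IsReal (R : realType) : real_or_complex R
  | IsComplex (R : realType) : real_or_complex R[i].

Definition separable (T : topologicalType) : Prop :=
  exists2 D : set T, countable D & dense D.

Section ConvexHulls.
Variables (K : numFieldType) (X : lmodType K).

Definition conv_hull (F : set X) : set X := smallest (@convex_set K X) F.

Definition aconv (F : set X) : set X :=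
  conv_hull [set w *: x | w in [set w : K | `|w| = 1] & x in F].

End ConvexHulls.

Section NormedSpaces.
Variables (K : numFieldType) (X : normedModType K).

Definition unit_ball : set X := [set x | `|x| <= 1].
Definition unit_sphere : set X := [set x | `|x| = 1].

(* Norms take their values in K.  When K is the complex field its order is the
   partial one (a <= b iff b - a is a nonnegative real), so a bound of a
   nonempty set of reals is real and suprema and infima of such sets are the
   usual real ones. *)

(* d is the distance from x to A; the empty set has no distance to x, which
   stands for the value +oo. *)
Definition is_dist (x : X) (A : set X) (d : K) : Prop :=
  infimums [set `|x - a| | a in A] d.

Record closed_subspace : Type := ClosedSubspace {
  subspace_set :> set X;
  subspace_submod : submod_closed (mem subspace_set);
  subspace_closed : closed subspace_set }.

End NormedSpaces.
Arguments unit_ball {K} X.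
Arguments unit_sphere {K} X.

(* A closed subspace as a normed space in its own right, with the norm (hence
   the topology) inherited from X. *)
Section SubspaceType.
Variables (K : numFieldType) (X : normedModType K) (E : closed_subspace X).

Definition subspace_pred : {pred X} := mem (subspace_set E).

HB.instance Definition _ :=
  GRing.isSubmodClosed.Build K X subspace_pred (subspace_submod E).

Record subspace_type : Type := InSubspace {
  subspace_val : X;
  _ : subspace_val \in subspace_pred }.

HB.instance Definition _ := [isSub for subspace_val].
HB.instance Definition _ := [Choice of subspace_type by <:].
HB.instance Definition _ := [SubChoice_isSubLmodule of subspace_type by <:].

Definition subspace_norm (x : subspace_type) : K := `|subspace_val x|.

Fact subspace_normD (x y : subspace_type) :
  subspace_norm (x + y) <= subspace_norm x + subspace_norm y.
Proof. exact: ler_normD. Qed.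

Fact subspace_normZ (l : K) (x : subspace_type) :
  subspace_norm (l *: x) = `|l| * subspace_norm x.
Proof. exact: normrZ. Qed.

Fact subspace_norm_eq0 (x : subspace_type) : subspace_norm x = 0 -> x = 0.
Proof. by move=> /normr0_eq0 x0; apply: val_inj; rewrite /= x0. Qed.

HB.instance Definition _ := Lmodule_isNormed.Build K subspace_type
  subspace_normD subspace_normZ subspace_norm_eq0.

End SubspaceType.

Section Operators.
Variables (K : numFieldType).

(* L(X, Y) *)
Record bounded_operator (X Y : normedModType K) : Type := BoundedOperator {
  operator_fun :> {linear X -> Y};
  operator_continuous : continuous operator_fun }.

Definition is_operator_norm (X Y : normedModType K)
    (G : bounded_operator X Y) (c : K) : Prop :=
  supremums [set `|G x| | x in unit_ball X] c.

(* Meaningful for G of norm one. *)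
Definition is_target (X Y Z : normedModType K)
    (G : bounded_operator X Y) (T : bounded_operator X Z) : Prop :=
  forall (x0 : X) (eps : K) (y : Y),
    unit_ball X x0 -> 0 < eps -> unit_sphere Y y ->
    exists F : set X,
      [/\ F `<=` unit_ball X,
          conv_hull F `<=` [set x | unit_ball X x /\ `|G x + y| > 2 - eps] &
          exists2 d, is_dist (T x0) (T @` aconv F) d & d < eps].

End Operators.

Section Restriction.
Variables (K : numFieldType) (X Z : normedModType K) (E : closed_subspace X).
Variable T : bounded_operator X Z.

Definition op_restrict_fun (x : subspace_type E) : Z := T (subspace_val x).

Fact op_restrict_linear : linear op_restrict_fun.
Proof. by move=> a x y; rewrite /op_restrict_fun /= linearP. Qed.

HB.instance Definition _ := GRing.isLinear.Build K (subspace_type E) Z _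
  op_restrict_fun op_restrict_linear.

Fact op_restrict_continuous : continuous op_restrict_fun.
Proof.
apply: bounded_linear_continuous.
have := @continuous_linear_bounded _ _ _ 0 T (@operator_continuous _ _ _ T 0).
move=> /linear_boundedP Tb; apply/linear_boundedP.
by apply: filterS Tb => r Tr x; exact: Tr.
Qed.

Definition op_restrict : bounded_operator (subspace_type E) Z :=
  BoundedOperator op_restrict_continuous.

End Restriction.

Section Corestriction.
Variables (K : numFieldType) (X Y : normedModType K).
Variables (E : closed_subspace X) (H : closed_subspace Y).
Variable G : bounded_operator X Y.
Hypothesis GEH : G @` E `<=` H.

Fact op_corestrict_subproof (x : subspace_type E) :
  G (subspace_val x) \in subspace_pred H.
Proof.
by rewrite inE; apply: GEH; exists (subspace_val x) => //; case: x => x /=; rewrite inE.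
Qed.

Definition op_corestrict_fun (x : subspace_type E) : subspace_type H :=
  InSubspace (op_corestrict_subproof x).

Fact op_corestrict_linear : linear op_corestrict_fun.
Proof. by move=> a x y; apply: val_inj; rewrite /= linearP. Qed.

HB.instance Definition _ := GRing.isLinear.Build K (subspace_type E)
  (subspace_type H) _ op_corestrict_fun op_corestrict_linear.

Fact op_corestrict_continuous : continuous op_corestrict_fun.
Proof.
apply: bounded_linear_continuous.
have := @continuous_linear_bounded _ _ _ 0 G (@operator_continuous _ _ _ G 0).
move=> /linear_boundedP Gb; apply/linear_boundedP.
by apply: filterS Gb => r Gr x; exact: Gr.
Qed.

Definition op_corestrict : bounded_operator (subspace_type E) (subspace_type H) :=
  BoundedOperator op_corestrict_continuous.

End Corestriction.

(* Main.v *)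
(* A convex combination involves finitely many points, so the set F in the
   definition of a target may be taken finite.  Choose such a finite F for every
   x, y and eps, and a point nearly attaining the norm of G for every eps.
   Starting from countable dense subsets of X0 and Y0, close up countably many
   pairs (x, y) under sums, scalars from a countable dense set, G, and these
   choices: the closures of the two projections are the required subspaces,
   because a witness for (x, y, eps) is still one for nearby data.  Conversely,
   a witness inside a subspace that contains the given x and y is one for G. *)
Require Import Defs.
From mathcomp Require Import all_boot all_order all_algebra.
From mathcomp Require Import complex ring.
From mathcomp Require Import all_classical all_reals all_analysis.

Set Implicit Arguments.
Unset Strict Implicit.
Unset Printing Implicit Defensive.

Import Order.TTheory GRing.Theory Num.Theory.
Import numFieldNormedType.Exports.

Local Open Scope classical_set_scope.
Local Open Scope ring_scope.

(** * Countability, dense scalars and infima *)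

Lemma countable_image (T U : Type) (f : T -> U) (A : set T) :
  countable A -> countable (f @` A).
Proof. by move=> cA; exact: sub_countable (card_image_le f A) cA. Qed.

Lemma countable_setU (T : Type) (A B : set T) :
  countable A -> countable B -> countable (A `|` B).
Proof.
by move=> cA cB; rewrite -bigcup2E; apply: bigcup_countable => // -[|[|[]]].
Qed.

(** Rationals are dense in the reals. For complex scalars it suffices to approximate real and
    imaginary parts within [e / 2], since the modulus is at most the sum of their absolute
    values. *)
Lemma scalar_separable (K : numFieldType) : real_or_complex K ->
  exists (I : countType) (q : I -> K),
    forall a e : K, 0 < e -> exists i, `|a - q i| < e.
Proof.
have ratP (R : realType) (a e : R) : 0 < e -> exists q : rat, `|a - ratr q| < e.
  move=> e0.
  have [|r [ar [q _ qr]]] := @dense_rat R (ball a e) _ (ball_open a e).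
    by exists a; exact: ballxx.
  by exists q; move: ar; rewrite -qr -ball_normE.
case=> R.
  by exists rat, ratr; exact: ratP.
exists (rat * rat)%type, (fun p => (ratr p.1 +i* ratr p.2)%C : R[i]).
move=> a e e0.
have eR : e = ((complex.Re e)%:C)%C by rewrite RRe_real// gtr0_real.
have e'0 : 0 < complex.Re e / 2 by rewrite divr_gt0// -ltcR -eR.
have [p ap] := ratP R (complex.Re a) _ e'0.
have [q aq] := ratP R (complex.Im a) _ e'0.
exists (p, q).
rewrite [X in `|X|]complexE.
apply: (le_lt_trans (ler_normD _ _)).
rewrite normrM !normc_def /= !expr0n !expr1n /= !addr0 add0r sqrtr1 mul1r !sqrtr_sqr.
rewrite eR -rmorphD ltcR [complex.Re e]splitr ltrD//; case: (a) ap aq => //.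
Qed.

(** Distances in [is_dist] have to exist as infima. Over the complex field the real infimum of the
    real parts works: a lower bound of a nonempty set of reals is itself real. *)
Lemma nonneg_infimum (K : numFieldType) : real_or_complex K ->
  forall A : set K, A !=set0 -> (forall x, A x -> 0 <= x) ->
  exists d, infimums A d.
Proof.
case=> R A [a Aa] A0.
  exists (inf A); split; last by move=> b Ab; apply: lb_le_inf => //; exists a.
  by apply: ge_inf; exists 0.
have AR x : A x -> x = ((complex.Re x)%:C)%C.
  by move=> /A0 x0; rewrite RRe_real// ger0_real.
pose B := [set complex.Re x | x in A].
have B0 : lbound B 0 by move=> _ [x Ax <-]; rewrite -lecR -AR// A0.
exists ((inf B)%:C)%C; split.
  move=> x Ax; rewrite (AR _ Ax) lecR; apply: ge_inf; first by exists 0.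
  by exists x.
move=> b Ab.
have bR : b = ((complex.Re b)%:C)%C.
  by rewrite RRe_real// (ler_real (Ab _ Aa)) ger0_real// A0.
rewrite bR lecR; apply: lb_le_inf; first by exists (complex.Re a), a.
by move=> _ [x Ax <-]; rewrite -lecR -bR -AR//; exact: Ab.
Qed.

(** Each stage adds the countably many values on pairs from the previous one. The stages increase,
    so two elements of the union lie in a common stage. *)
Lemma countable_closure (T : Type) (I : countType) (f : I -> T -> T -> T)
    (S : set T) : countable S ->
  exists D : set T, [/\ countable D, S `<=` D &
    forall i a b, D a -> D b -> D (f i a b)].
Proof.
move=> cS.
pose step (A : set T) := A `|` \bigcup_i [set f i p.1 p.2 | p in A `*` A].
pose D n := iter n step S.
have cD n : countable (D n).
  elim: n => //= n IHn; apply: countable_setU => //.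
  by apply: bigcup_countable => // i _; apply: countable_image; exact: countableX.
have Dle m n : (m <= n)%N -> D m `<=` D n.
  elim: n => [|n IHn]; first by rewrite leqn0 => /eqP ->.
  rewrite leq_eqVlt ltnS => /predU1P[->//|/IHn mn].
  by apply: (subset_trans mn) => x; left.
exists (\bigcup_n D n); split; first exact: bigcup_countable.
  by move=> x Sx; exists 0%N.
move=> i a b [m _ Dma] [n _ Dnb]; exists (maxn m n).+1 => //=; right.
exists i => //; exists (a, b) => //; split.
- exact: Dle (leq_maxl m n) _ Dma.
- exact: Dle (leq_maxr m n) _ Dnb.
Qed.

(** * Convex and absolutely convex hulls *)

Section Hulls.
Variable K : numFieldType.
Implicit Types X Y : lmodType K.

Lemma conv_hull_convex X (F : set X) : convex_set (conv_hull F).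
Proof.
move=> x y l /set_mem Hx /set_mem Hy; apply/mem_set => A [cA FA].
apply/set_mem/cA; apply/mem_set; [exact: Hx | exact: Hy].
Qed.

Lemma sub_conv_hull X (F : set X) : F `<=` conv_hull F.
Proof. exact: (@sub_smallest _ (@convex_set K X)). Qed.

Lemma conv_hullS X (F F' : set X) : F `<=` F' -> conv_hull F `<=` conv_hull F'.
Proof. exact: sub_smallest2r (@conv_hull_convex X F'). Qed.

Lemma aconvS X (F F' : set X) : F `<=` F' -> aconv F `<=` aconv F'.
Proof.
move=> FF'; apply: conv_hullS => _ [w w1 [x Fx <-]].
by exists w => //; exists x => //; exact: FF'.
Qed.

Lemma linear_conv X Y (f : {linear X -> Y}) (l : {i01 K}) (x y : X) :
  f (conv l (x : convex_lmodType X) (y : convex_lmodType X)) =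
  conv l (f x : convex_lmodType Y) (f y : convex_lmodType Y).
Proof. by rewrite /conv/= linearD !linearZ. Qed.

(** Images and preimages of convex sets under a linear map are convex, so minimality of the hull
    gives each inclusion. *)
Lemma conv_hull_image X Y (f : {linear X -> Y}) (F : set X) :
  conv_hull (f @` F) = f @` conv_hull F.
Proof.
apply/seteqP; split.
  apply: smallest_sub; last by apply: image_subset; exact: sub_conv_hull.
  move=> _ _ l /set_mem[x Fx <-] /set_mem[y Fy <-]; apply/mem_set.
  rewrite -linear_conv; exists (conv l (x : convex_lmodType X) y) => //.
  by apply: set_mem; apply: conv_hull_convex; apply: mem_set.
suff H : conv_hull F `<=` f @^-1` conv_hull (f @` F).
  by move=> _ [x Fx <-]; exact: H.
apply: smallest_sub; last by move=> x Fx; apply: sub_conv_hull; exists x.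
move=> x y l /set_mem Hx /set_mem Hy; apply/mem_set; rewrite /= linear_conv.
by apply: set_mem; apply: conv_hull_convex; apply: mem_set.
Qed.

Lemma aconv_image X Y (f : {linear X -> Y}) (F : set X) :
  aconv (f @` F) = f @` aconv F.
Proof.
rewrite -conv_hull_image; congr conv_hull; apply/seteqP; split.
  move=> _ [w w1 [_ [x Fx <-] <-]]; exists (w *: x); last by rewrite linearZ.
  by exists w => //; exists x.
move=> _ [_ [w w1 [x Fx <-]] <-]; exists w => //; exists (f x); first by exists x.
by rewrite linearZ.
Qed.

(** The points reached from finite parts of [F] form a convex set, because two lists can be
    concatenated, and this set contains every [w *: x]. *)
Lemma aconv_finite X (F : set X) (a : X) : aconv F a ->
  exists2 s : seq X, [set` s] `<=` F & aconv [set` s] a.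
Proof.
move: a; apply: smallest_sub.
  move=> x y l /set_mem[s sF Hx] /set_mem[t tF Hy]; apply/mem_set.
  exists (s ++ t).
    by move=> z /=; rewrite mem_cat => /orP[/sF|/tF].
  apply: set_mem; apply: conv_hull_convex; apply: mem_set.
    by apply: aconvS Hx => z /= zs; rewrite mem_cat zs.
  by apply: aconvS Hy => z /= zs; rewrite mem_cat zs orbT.
move=> _ [w w1 [x Fx <-]]; exists [:: x].
  by move=> z /=; rewrite inE => /eqP ->.
by apply: sub_conv_hull; exists w => //; exists x => //=; rewrite inE.
Qed.

End Hulls.

(** * Closures and separable subspaces *)

Lemma closure_normP (K : numFieldType) (X : normedModType K) (D : set X) (x : X) :
  closure D x <-> forall e, 0 < e -> exists2 d, D d & `|x - d| < e.
Proof.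
split=> [Dx e e0|Dx B /nbhs_ballP[e /= e0 xeB]].
  have [d [Dd]] := Dx _ (nbhsx_ballx x e e0).
  by rewrite -ball_normE => xd; exists d.
have [d Dd xd] := Dx e e0; exists d; split => //.
by apply: xeB; rewrite -ball_normE.
Qed.

(** The [+ 1] keeps the divisor positive when [a] is zero. *)
Lemma mulr_lt_pdiv (K : numFieldType) (a b c : K) :
  0 <= a -> 0 <= b -> b < c / (a + 1) -> a * b < c.
Proof.
move=> a0 b0; rewrite ltr_pdivlMr ?ltr_wpDl// => bc.
by apply: le_lt_trans bc; rewrite mulrC ler_wpM2l// lerDl.
Qed.

Section Subspaces.
Variables (K : numFieldType) (X : normedModType K).

Lemma closure_submod (I : Type) (q : I -> K) (D : set X) :
    (forall a e, 0 < e -> exists i, `|a - q i| < e) ->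
    D 0 -> (forall u v, D u -> D v -> D (u + v)) ->
    (forall i u, D u -> D (q i *: u)) ->
  submod_closed (mem (closure D)).
Proof.
move=> qd D0 DD DZ; split; first by apply/mem_set/subset_closure.
move=> a u v /set_mem/closure_normP uD /set_mem/closure_normP vD.
apply/mem_set/closure_normP => e e0.
have e30 : 0 < e / 3 by rewrite divr_gt0.
have [v' Dv' vv'] := vD _ e30.
have a0 : 0 < `|a| + 1 by rewrite ltr_wpDl.
have [u' Du' uu'] := uD _ (divr_gt0 e30 a0).
have u0 : 0 < `|u'| + 1 by rewrite ltr_wpDl.
(* The scalar is approximated after [u'], because its tolerance depends on the norm of [u']; each of
   the three errors is then below [e / 3]. *)
have [i aq] := qd a _ (divr_gt0 e30 u0).
exists (q i *: u' + v'); first by apply: DD => //; exact: DZ.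
have -> : a *: u + v - (q i *: u' + v') = a *: (u - u') + (a - q i) *: u' + (v - v').
  by rewrite opprD addrACA scalerBr scalerBl subrKA.
have -> : e = e / 3 + e / 3 + e / 3 by field.
apply: (le_lt_trans (ler_normD _ _)); rewrite ltrD//.
apply: (le_lt_trans (ler_normD _ _)); rewrite !normrZ ltrD//.
  exact: mulr_lt_pdiv.
by rewrite mulrC; exact: mulr_lt_pdiv.
Qed.

Lemma closure_separable_subspace (I : Type) (q : I -> K) (D : set X) : countable D ->
    (forall a e, 0 < e -> exists i, `|a - q i| < e) ->
    D 0 -> (forall u v, D u -> D v -> D (u + v)) ->
    (forall i u, D u -> D (q i *: u)) ->
  exists2 E : closed_subspace X, subspace_set E = closure D &
    separable (subspace_type E).
Proof.
move=> cD qd D0 DD DZ.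
exists (ClosedSubspace (closure_submod qd D0 DD DZ) (@closed_closure _ D)) => //.
set E := ClosedSubspace _ _.
exists (@subspace_val _ _ E @^-1` D).
  have /countable_injP[f finj] := cD.
  apply/countable_injP; exists (f \o @subspace_val _ _ E) => u v /set_mem uD /set_mem vD.
  by move=> /finj uv; apply/val_inj/uv; exact/mem_set.
move=> O [x Ox] Oo.
have /nbhs_ballP[e /= e0 xeO] := open_nbhs_nbhs (conj Oo Ox).
have /set_mem/closure_normP/(_ e e0)[d Dd xd] : subspace_val x \in closure D.
  by case: (x).
have Ed : d \in subspace_pred E by apply/mem_set/subset_closure.
by exists (InSubspace Ed); split => //; apply: xeO; rewrite -ball_normE.
Qed.

Lemma separable_subspace_dense (E : closed_subspace X) :
  separable (subspace_type E) ->
  exists2 D : set X, countable D & E `<=` closure D.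
Proof.
move=> [D cD Dd]; exists (@subspace_val _ _ E @` D); first exact: countable_image.
move=> x Ex; have xE : x \in subspace_pred E by exact: mem_set.
apply/closure_normP => e e0.
have [|d [xd Dd']] := Dd (ball (InSubspace xE) e) _ (ball_open _ _).
  by exists (InSubspace xE); exact: ballxx.
exists (subspace_val d); first by exists d.
by move: xd; rewrite -ball_normE.
Qed.

End Subspaces.

(** Pairs are closed up at once, because [phi] draws on both spaces and [G] links them; the two
    projections inherit the closure properties. *)
Lemma separable_subspace_pair (K : numFieldType) (X Y : normedModType K)
    (I J : countType) (q : I -> K) (G : bounded_operator X Y)
    (phi : J -> X -> Y -> X) (S : set X) (S' : set Y) :
    (forall a e, 0 < e -> exists i, `|a - q i| < e) ->
    countable S -> countable S' ->
  exists (D : set X) (D' : set Y) (E : closed_subspace X) (H : closed_subspace Y),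
    [/\ subspace_set E = closure D /\ subspace_set H = closure D',
        separable (subspace_type E) /\ separable (subspace_type H),
        S `<=` D /\ S' `<=` D',
        forall j x y, D x -> D' y -> D (phi j x y) &
        G @` E `<=` H].
Proof.
move=> qd cS cS'.
(* Unary operations ignore [b], and a component with nothing to add is filled with 0. The choice
   [phi] takes its arguments from two pairs, as [x] and [y] may come from different ones. *)
pose f (o : option (option (I + J))) (a b : X * Y) : X * Y := match o with
  | None => (a.1 + b.1, a.2 + b.2)
  | Some None => (0, G a.1)
  | Some (Some (inl i)) => (q i *: a.1, q i *: a.2)
  | Some (Some (inr j)) => (phi j a.1 b.2, 0)
  end.
have [|D [cD SD fD]] := @countable_closure _ _ f ((0 |` S) `*` (0 |` S')).
  by apply: countableX; exact: countable_setU.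
have DX0 : (fst @` D) 0 by exists (0, 0) => //; apply: SD; split; left.
have DY0 : (snd @` D) 0 by exists (0, 0) => //; apply: SD; split; left.
have [|||E EE sE] := @closure_separable_subspace _ X I q (fst @` D) _ qd DX0.
- exact: countable_image.
- by move=> _ _ [a Da <-] [b Db <-]; exists (f None a b) => //; exact: fD.
- by move=> i _ [a Da <-]; exists (f (Some (Some (inl i))) a a) => //; exact: fD.
have [|||H HH sH] := @closure_separable_subspace _ Y I q (snd @` D) _ qd DY0.
- exact: countable_image.
- by move=> _ _ [a Da <-] [b Db <-]; exists (f None a b) => //; exact: fD.
- by move=> i _ [a Da <-]; exists (f (Some (Some (inl i))) a a) => //; exact: fD.
exists (fst @` D), (snd @` D), E, H; split => //.
- split.
    by move=> x Sx; exists (x, 0) => //; apply: SD; split; [right|left].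
  by move=> y Sy; exists (0, y) => //; apply: SD; split; [left|right].
- move=> j _ _ [a Da <-] [b Db <-].
  by exists (f (Some (Some (inr j))) a b) => //; exact: fD.
(* By continuity [G] maps the closure of the first projection into the closure of the second. *)
rewrite EE HH => _ [x Dx <-] B GxB.
have [_ [[a Da <-] Ba]] := Dx _ (@operator_continuous _ _ _ G x _ GxB).
by exists (G a.1); split => //; exists (f (Some None) a a) => //; exact: fD.
Qed.

(** * Targets through finite witnesses *)

Section Targets.
Variables (K : numFieldType) (X Y Z : normedModType K).
Variables (G : bounded_operator X Y) (T : bounded_operator X Z).

(** A near point [a] replaces the distance and its infimum. *)
Definition target_witness (x0 : X) (eps : K) (y : Y) (F : set X) : Prop :=
  conv_hull F `<=` [set x | unit_ball X x /\ `|G x + y| > 2 - eps] /\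
  exists2 a, aconv F a & `|T x0 - T a| < eps.

Lemma is_dist_lt (x : Z) (A : set Z) (d e : K) :
  is_dist x A d -> 0 < e -> d < e -> exists2 a, A a & `|x - a| < e.
Proof.
move=> [_ dA] e0 de; apply: contrapT => noa.
suff /dA ed : lbound [set `|x - a| | a in A] e.
  by move: (lt_le_trans de ed); rewrite ltxx.
move=> _ [a Aa <-]; rewrite real_leNgt ?normr_real ?gtr0_real//.
by apply/negP => xa; apply: noa; exists a.
Qed.

(** A point of [aconv F] uses finitely many points of [F], and passing to these shrinks
    [conv_hull F], so the norm condition survives. Conversely, the near point bounds the infimum
    from above. *)
Lemma is_targetP : real_or_complex K ->
  is_target G T <->
  forall x0 eps y, unit_ball X x0 -> 0 < eps -> unit_sphere Y y ->
    exists s : seq X, target_witness x0 eps y [set` s].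
Proof.
move=> hK; split=> [GT|GT] x0 eps y x01 eps0 y1.
  have [F [_ FG [d dd deps]]] := GT x0 eps y x01 eps0 y1.
  have [_ [a aF <-] Ta] := is_dist_lt dd eps0 deps.
  have [s sF sa] := aconv_finite aF.
  exists s; split; last by exists a.
  by apply: subset_trans FG; exact: conv_hullS.
have [s [sG [a sa Ta]]] := GT x0 eps y x01 eps0 y1.
exists [set` s]; split => //.
  by move=> x /sub_conv_hull/sG[].
have [||d dinf] := nonneg_infimum hK (A := [set `|T x0 - b| | b in T @` aconv [set` s]]).
- by exists `|T x0 - T a|, (T a) => //; exists a.
- by move=> _ [b _ <-].
exists d => //; apply: le_lt_trans Ta; apply: dinf.1.
by exists (T a) => //; exists a.
Qed.

Lemma bounded_operator_le : exists2 C : K, 0 <= C & forall x, `|T x| <= C * `|x|.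
Proof.
have := @continuous_linear_bounded _ _ _ 0 T (@operator_continuous _ _ _ T 0).
move=> /linear_boundedP[M [Mr MT]].
exists (`|M| + 1); first by rewrite addr_ge0.
by apply: MT; rewrite (le_lt_trans (real_ler_norm Mr))// ltrDl.
Qed.

(** The same [F] serves: moving [y] costs its displacement by the reverse triangle inequality,
    moving [x] costs at most [C] times its displacement, and [eps - eta] absorbs each cost. *)
Lemma target_witness_perturb (C : K) (x0 x1 : X) (y0 y1 : Y) (eps eta : K)
    (F : set X) :
    (forall x, `|T x| <= C * `|x|) ->
    eta + `|y0 - y1| <= eps -> eta + C * `|x0 - x1| <= eps ->
  target_witness x1 eta y1 F -> target_witness x0 eps y0 F.
Proof.
move=> TC yeps xeps [FG [a Fa Ta]]; split.
  move=> x /FG[x1' Gx]; split => //=.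
  have -> : G x + y0 = (G x + y1) - (y1 - y0) by rewrite opprB addrA addrAC addrK.
  apply: lt_le_trans (lerB_dist _ _); rewrite distrC ltrBrDr.
  apply: le_lt_trans Gx.
  have -> : 2 - eps + `|y0 - y1| = 2 - eta - (eps - (eta + `|y0 - y1|)) by ring.
  by rewrite gerBl subr_ge0.
exists a => //; apply: lt_le_trans xeps.
have -> : T x0 - T a = (T x1 - T a) + T (x0 - x1) by rewrite linearB [RHS]addrC subrKA.
by apply: (le_lt_trans (ler_normD _ _)); rewrite ltr_leD.
Qed.

Lemma operator_norm_attained (c e : K) :
  is_operator_norm G c -> c \is Num.real -> 0 < e ->
  exists2 x, unit_ball X x & c - e < `|G x|.
Proof.
move=> [_ cG] cr e0; apply: contrapT => nox.
suff /cG : ubound [set `|G x| | x in unit_ball X] (c - e).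
  by rewrite lerBrDr gerDl => /(lt_le_trans e0); rewrite ltxx.
move=> _ [x x1 <-]; rewrite real_leNgt ?normr_real ?realB ?(gtr0_real e0)//.
by apply/negP => xc; apply: nox; exists x.
Qed.

End Targets.

(** * Witnesses inside subspaces *)

Section Restrictions.
Variables (K : numFieldType) (X Y Z : normedModType K).
Variables (G : bounded_operator X Y) (T : bounded_operator X Z).
Variables (E : closed_subspace X) (H : closed_subspace Y).
Variable GEH : G @` E `<=` H.

(** The inclusion is linear and isometric, so it commutes with both hulls and preserves the norms
    involved. *)
Lemma target_witness_restrict (x0 : subspace_type E) (eps : K)
    (y : subspace_type H) (F : set (subspace_type E)) :
  target_witness (op_corestrict GEH) (op_restrict E T) x0 eps y F <->
  target_witness G T (subspace_val x0) eps (subspace_val y) (val @` F).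
Proof.
pose v : {linear subspace_type E -> X} := val.
rewrite /target_witness -[val]/(v : _ -> _) aconv_image conv_hull_image.
split=> -[FG [a Fa Ta]]; split.
- by move=> _ [x /FG + <-].
- by exists (val a) => //; exists a.
- by move=> x Fx; apply: (FG (v x)); exists x.
- by case: Fa Ta => b Fb <- Tb; exists b.
Qed.

End Restrictions.

(** * Approximation within the ball and the sphere *)

Section Approximation.
Variables (K : numFieldType) (X : normedModType K).

(* Approximating (1 - e) x instead of x keeps the approximant in the ball. *)
Lemma shrunk_approximation (x d : X) (e : K) :
  0 < e -> e <= 1 -> `|x| <= 1 -> `|(1 - e) *: x - d| < e ->
  `|d| <= 1 /\ `|x - d| <= e + e.
Proof.
move=> e0 e1 x1 xd; split.
  have -> : d = (1 - e) *: x - ((1 - e) *: x - d) by rewrite subKr.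
  apply: (le_trans (ler_normB _ _)).
  rewrite -[leRHS](subrK e).
  apply: lerD; last exact: ltW.
  by rewrite normrZ ger0_norm ?subr_ge0// ler_piMr ?subr_ge0.
have -> : x - d = e *: x + ((1 - e) *: x - d).
  by rewrite scalerBl scale1r addrA [e *: x + _]addrC subrK.
apply: (le_trans (ler_normD _ _)); apply: lerD; last exact: ltW.
by rewrite normrZ gtr0_norm// ler_piMr// ltW.
Qed.

Lemma normalize_norm (d : X) : d != 0 -> `| `|d|^-1 *: d| = 1.
Proof. by move=> d0; rewrite normrZ normfV normr_id mulVf// normr_eq0. Qed.

(** The norm of [d] differs from 1 by less than [e], so normalising moves [d] by at most [e] more;
    [e <= 1] excludes [d = 0]. *)
Lemma normalize_approximation (y d : X) (e : K) :
  e <= 1 -> `|y| = 1 -> `|y - d| < e ->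
  d != 0 /\ `|y - `|d|^-1 *: d| <= e + e.
Proof.
move=> e1 y1 yd.
have d0 : d != 0.
  apply: contraTneq yd => ->; rewrite subr0 y1; apply/negP => /lt_le_trans/(_ e1).
  by rewrite ltxx.
split => //.
have -> : y - `|d|^-1 *: d = (y - d) + (`|d| - 1) *: (`|d|^-1 *: d).
  by rewrite scalerBl scale1r scalerA mulfV ?normr_eq0// scale1r subrKA.
apply: (le_trans (ler_normD _ _)); apply: lerD; first exact: ltW.
rewrite normrZ normalize_norm// mulr1 -y1 distrC.
exact: le_trans (ler_dist_dist _ _) (ltW yd).
Qed.

End Approximation.

(** * Separable determination of targets *)

Theorem theorem3p13 (K : numFieldType) (hK : real_or_complex K)
    (X Y Z : completeNormedModType K)
    (G : bounded_operator X Y) (T : bounded_operator X Z)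
    (hG : is_operator_norm G 1) :
  is_target G T <->
  forall (X0 : closed_subspace X) (Y0 : closed_subspace Y),
    separable (subspace_type X0) -> separable (subspace_type Y0) ->
    exists (Xoo : closed_subspace X) (Yoo : closed_subspace Y),
      [/\ separable (subspace_type Xoo), separable (subspace_type Yoo),
          X0 `<=` Xoo, Y0 `<=` Yoo &
          exists GXY : G @` Xoo `<=` Yoo,
            is_operator_norm (op_corestrict GXY) 1 /\
            is_target (op_corestrict GXY) (op_restrict Xoo T)].
Proof.
have [I [q qd]] := scalar_separable hK.
split=> [/(is_targetP _ _ hK) GT X0 Y0 sX0 sY0|GT]; last first.
  apply/is_targetP => // x0 eps y x01 eps0 y1.
  (* Separable subspaces containing [x0] and [y] are all that is wanted here, so the choice function
     is trivial. *)
  have [D [D' [X0 [Y0 [[X0E Y0E] [sX0 sY0] [xD yD'] _ _]]]]] :=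
    separable_subspace_pair G (fun (_ : I) (x : X) (_ : Y) => x) qd
      (countable1 x0) (countable1 y).
  have [E [H [_ _ X0E' Y0H' [GEH [_ /(is_targetP _ _ hK) GTE]]]]] := GT X0 Y0 sX0 sY0.
  have x0E : x0 \in subspace_pred E.
    by apply/mem_set/X0E'; rewrite X0E; exact/subset_closure/xD.
  have yH : y \in subspace_pred H.
    by apply/mem_set/Y0H'; rewrite Y0E; exact/subset_closure/yD'.
  have [s /target_witness_restrict/= sw] :=
    GTE (InSubspace x0E) eps (InSubspace yH) x01 eps0 y1.
  exists (map val s); congr target_witness: sw; apply/seteqP; split.
    by move=> _ [x xs <-]; exact: map_f.
  by move=> x /mapP[x' xs ->]; exists x'.
have [DX cDX XDX] := separable_subspace_dense sX0.
have [DY cDY YDY] := separable_subspace_dense sY0.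
(* The moduli [|q i|] serve as a countable supply of tolerances; 0 is a default where [q i = 0]. *)
have /choice[psi psiP] : forall i, exists x : X,
    q i != 0 -> unit_ball X x /\ 1 - `|q i| < `|G x|.
  move=> i; have [->|qi0] := eqVneq (q i) 0; first by exists 0.
  have [|x x1 Gx] := operator_norm_attained hG (@real1 _) (e := `|q i|).
    by rewrite normr_gt0.
  by exists x.
(* A point [y] of the countable set need not have norm one, so it is normalised. The empty list is
   the default outside the conditions. *)
have /choice[phi phiP] : forall p : X * Y * I, exists s : seq X,
    unit_ball X p.1.1 -> p.1.2 != 0 -> q p.2 != 0 ->
    target_witness G T p.1.1 `|q p.2| (`|p.1.2|^-1 *: p.1.2) [set` s].
  move=> [[x y] i] /=.
  have [[x1 [y0 qi0]]|no] := pselect (unit_ball X x /\ y != 0 /\ q i != 0).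
    have [||s sw] := GT x `|q i| (`|y|^-1 *: y) x1.
    - by rewrite normr_gt0.
    - exact: normalize_norm.
    by exists s.
  by exists [::] => x1 y0 qi0; exfalso; apply: no.
(* Lists enter one entry at a time, indexed by [nat]; past the end [nth] returns 0, which merely
   joins [D]. *)
have [|D [D' [E [H [[EE HH] [sE sH] [SD YD'] phiD GEH]]]]] :=
  @separable_subspace_pair K X Y I (I * nat)%type q G
    (fun j x y => nth 0 (phi (x, y, j.1)) j.2) (DX `|` range psi) DY qd _ cDY.
  by apply: countable_setU => //; exact: countable_image.
have DE : D `<=` E by rewrite EE; exact: subset_closure.
(* A scalar at distance less than [e / 2] from [e / 2] is nonzero and has modulus below [e]. *)
have smallq (e : K) : 0 < e -> exists2 i, q i != 0 & `|q i| < e.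
  move=> e0; have e20 : 0 < e / 2 by rewrite divr_gt0.
  have [i qi] := qd (e / 2) _ e20; exists i.
    by apply: contraTneq qi => ->; rewrite subr0 gtr0_norm// ltxx.
  have -> : q i = e / 2 - (e / 2 - q i) by rewrite subKr.
  apply: (le_lt_trans (ler_normB _ _)).
  by rewrite [ltRHS]splitr gtr0_norm// ltrD2l.
exists E, H; split => //.
- by move=> x /XDX; rewrite EE; apply: closure_subset => z Dz; apply: SD; left.
- by move=> y /YDY; rewrite HH; exact: closure_subset.
exists GEH; split.
  split=> [_ [x x1 <-]|c cG]; first by apply: hG.1; exists (subspace_val x).
  (* Nonnegativity makes [c] real, hence comparable with 1 over the complex field too. *)
  have c0 : 0 <= c.
    apply: le_trans (cG `|op_corestrict GEH 0| _) => //.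
    by exists 0 => //; rewrite /unit_ball /= normr0.
  (* If [c < 1], a point [psi i] with [|q i| < 1 - c] satisfies [|G (psi i)| > c]. *)
  rewrite real_leNgt ?real1 ?ger0_real//; apply/negP => c1.
  have [i qi0 qi] : exists2 i, q i != 0 & `|q i| < 1 - c.
    by apply: smallq; rewrite subr_gt0.
  have [x1 Gx] := psiP i qi0.
  have xE : psi i \in subspace_pred E by apply/mem_set/DE/SD; right; exists i.
  have Gc : `|G (psi i)| <= c by apply: cG; exists (InSubspace xE).
  have := lt_le_trans Gx Gc; rewrite ltrBlDr addrC -ltrBlDr.
  by move/(lt_trans qi); rewrite ltxx.
apply/is_targetP => // x0 eps y x01 eps0 y1.
have [C C0 TC] := bounded_operator_le T.
have k0 : 0 < eps + 3 + (C + C) by rewrite -addrA ltr_pwDl// !addr_ge0.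
(* In the denominator, [eps] ensures [e <= 1], the 3 pays for a tolerance [e] plus a displacement
   [2e] of [y], and [C + C] with part of the 3 pays for [e] plus [C] times a displacement [2e] of
   [x0]. *)
pose e := eps / (eps + 3 + (C + C)).
have e0 : 0 < e by rewrite divr_gt0.
have e1 : e <= 1 by rewrite ler_pdivrMr// mul1r -addrA lerDl !addr_ge0.
have ge0e : 0 <= e by exact: ltW.
have e3 : e + (e + e) <= eps.
  have -> : eps = e + (e + e) + ((C + C) * e + eps * e).
    by rewrite /e; field; rewrite gt_eqF.
  by rewrite lerDl addr_ge0// mulr_ge0 ?addr_ge0// ltW.
have eC : e + C * (e + e) <= eps.
  have -> : eps = e + C * (e + e) + (e + e + eps * e).
    by rewrite /e; field; rewrite gt_eqF.
  by rewrite lerDl !addr_ge0// mulr_ge0// ltW.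
have /closure_normP/(_ e e0)[d Dd xd] : closure D ((1 - e) *: subspace_val x0).
  rewrite -EE; have := valP ((1 - e) *: x0); exact: set_mem.
have /closure_normP/(_ e e0)[d' Dd' yd'] : closure D' (subspace_val y).
  by rewrite -HH; have := valP y; exact: set_mem.
have [d1 x0d] :=
  shrunk_approximation e0 e1 (x01 : `|subspace_val x0| <= 1) xd.
have [d'0 yd] :=
  normalize_approximation e1 (y1 : `|subspace_val y| = 1) yd'.
have [i qi0 /ltW qi] := smallq e e0.
have sD : [set` phi (d, d', i)] `<=` D.
  move=> x /(nthP 0)[k _ <-]; exact: (phiD (i, k)).
(* All entries lie in [D], hence in [E], so [insub] drops none of them. *)
exists (pmap (insub : X -> option (subspace_type E)) (phi (d, d', i))).
apply/target_witness_restrict.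
have -> : val @` [set` pmap (insub : X -> option (subspace_type E))
    (phi (d, d', i))] = [set` phi (d, d', i)].
  apply/seteqP; split=> [_ [u + <-]|x xs]; first by rewrite /= mem_pmap_sub.
  have xE : x \in subspace_pred E by exact/mem_set/DE/sD.
  by exists (InSubspace xE); rewrite //= mem_pmap_sub.
(* The chosen witness has tolerance [|q i| <= e], and both data have moved by at most [2e]. *)
apply: target_witness_perturb TC _ _ (phiP (d, d', i) d1 d'0 qi0).
- by apply: le_trans e3; exact: lerD.
- by apply: le_trans eC; apply: lerD => //; exact: ler_wpM2l.
Qed.
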